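(* Let $s$ be a perfect square (a positive integer of the form $s=m^2$). Then there do not exist positive integers $d,u,v$ with $\frac{4}{s}=\frac{1}{duv}+\frac{1}{dus}+\frac{1}{dvs}$; that is, $s$ has no Type B solution (whether or not of Type II).
   Context: A Type B solution for a positive integer $a$ is a triple $(duv,dua,dva)$ with $d,u,v$ positive integers satisfying $\frac{4}{a}=\frac{1}{duv}+\frac{1}{dua}+\frac{1}{dva}$. *)

(* Defs.v *)
From mathcomp Require Import all_boot all_order all_algebra.

Set Implicit Arguments.
Unset Strict Implicit.
Unset Printing Implicit Defensive.

Import GRing.Theory.
Local Open Scope ring_scope.

Definition type_B_equation (a d u v : nat) : Prop :=
  4 / a%:R = 1 / (d * u * v)%:R + 1 / (d * u * a)%:R + 1 / (d * v * a)%:R :> rat.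

Definition type_B_solution (a : nat) (t : nat * nat * nat) : Prop :=
  exists d u v : nat,
    [/\ (0 < d)%N, (0 < u)%N, (0 < v)%N,
        t = (d * u * v, d * u * a, d * v * a)%N & type_B_equation a d u v].

(* Main.v *)
Require Import Defs.
From mathcomp Require Import all_boot all_order all_algebra.
From mathcomp Require Import zify ring.
Import GRing.Theory.
Local Open Scope ring_scope.

(** Clearing denominators, a solution satisfies [u + v + m^2 = 4duv], that is
[u + m^2 = v n] with [n = 4du - 1], so that [-u] is a square modulo [n].
Gauss's lemma refutes this.  Call a residue modulo [n] negative if it lies in
the upper half, and for [a] prime to [n] let G(a) be the parity of the number
of [x] in [0, 2du) with [a x] negative.  Then G(m^2) = 2 G(m) is even, because
[x |-> |m x|] permutes this half system.  Negating flips all the [2du - 1]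
nonzero elements, so G(-u) differs from G(u).  Finally [u x] is negative iff
[x %/ 2d] is odd, which depends only on [x %/ 2], so G(u) is even. *)

Section HalfSystem.

Local Open Scope nat_scope.

Variables (K n : nat).
Hypotheses (K_gt0 : 0 < K) (nE : n.+1 = 4 * K).

Definition upper_half (y : nat) : bool := 2 * K <= y %% n.

Definition abs_residue (y : nat) : nat :=
  if upper_half y then n - y %% n else y %% n.

Let n_gt0 : 0 < n. Proof. lia. Qed.

(** The two residues are nonzero and sum to [n = 2 * (2 * K) - 1], so exactly one of them reaches
    [2 * K]. *)
Lemma upper_half_opp (a b : nat) :
  n %| a + b -> ~~ (n %| a) -> upper_half b = ~~ upper_half a.
Proof.
rewrite /upper_half /dvdn -modnDm => + a_neq0.
have := ltn_pmod a n_gt0; have := ltn_pmod b n_gt0.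
move: (a %% n) (b %% n) a_neq0 => p q p_neq0 lt_qn lt_pn /eqP pq0.
have: p + q = n; last by lia.
have := divn_eq (p + q) n; rewrite pq0.
have: (p + q) %/ n < 2 by rewrite ltn_divLR //; lia.
case: ((p + q) %/ n) => [|[|//]]; lia.
Qed.

Lemma abs_residue_lt (y : nat) : abs_residue y < 2 * K.
Proof.
rewrite /abs_residue /upper_half; have := ltn_pmod y n_gt0; case: ifP; lia.
Qed.

(** Replacing [y] by [abs_residue y] negates [a * y] modulo [n] exactly when [y] is negative.
    Negation flips nonzero residues only, hence the disjunction; if [n] divides [y], nothing is
    negated. *)
Lemma upper_half_mul_abs (a y : nat) : ~~ (n %| a * y) || (n %| y) ->
  upper_half (a * y) = upper_half y (+) upper_half (a * abs_residue y).
Proof.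
rewrite /abs_residue; case: ifP => [y_neg | _] ay_neq0; last first.
  by rewrite /upper_half modnMmr.
case/orP: ay_neq0 => [ay_neq0|]; last first.
  by move: y_neg; rewrite /upper_half /dvdn => ? /eqP; lia.
rewrite [upper_half (a * (n - _))](@upper_half_opp (a * y)) //=.
  by rewrite negbK.
rewrite /dvdn -mulnDr -modnMmr -modnDml subnKC ?modnn ?muln0 ?mod0n //.
by rewrite ltnW // ltn_pmod.
Qed.

Lemma abs_residue_mul_inj (m x y : nat) : coprime n m ->
  x < 2 * K -> y < 2 * K -> abs_residue (m * x) = abs_residue (m * y) -> x = y.
Proof.
move=> co_nm x_lt y_lt eq_abs.
have: (m * x = m * y %[mod n]) \/ n %| m * x + m * y.
  move: eq_abs; rewrite /abs_residue /dvdn -[(_ + _) %% n]modnDm.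
  have := ltn_pmod (m * x) n_gt0; have := ltn_pmod (m * y) n_gt0.
  move: (m * x %% n) (m * y %% n) => p q lt_q lt_p.
  case: ifP => _; case: ifP => _ E; try by left; lia.
  - by right; rewrite (_ : p + q = n) ?modnn; last lia.
  - by right; rewrite (_ : p + q = n) ?modnn; last lia.
case=> [|].
  wlog le_xy : x y x_lt y_lt eq_abs / x <= y.
    move=> W E; case: (leqP x y) => [|/ltnW] le; first exact: W.
    by symmetry; apply: W.
  move/esym/eqP; rewrite eqn_mod_dvd ?leq_mul2l ?le_xy ?orbT //.
  rewrite -mulnBr Gauss_dvdr // => /dvdn_leq; lia.
(* Here [n] divides [x + y <= 4 * K - 2 < n], so both are zero. *)
rewrite -mulnDr Gauss_dvdr // => /dvdn_leq; lia.
Qed.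

Lemma gauss_parity_square (m : nat) : coprime n m ->
  \big[addb/false]_(x < 2 * K) upper_half (m * (m * x)) = false.
Proof.
move=> co_nm.
pose f (x : 'I_(2 * K)) := Ordinal (abs_residue_lt (m * x)).
have f_inj : injective f.
  move=> x y /(congr1 val) /= /abs_residue_mul_inj E.
  by apply/val_inj/E.
transitivity (\big[addb/false]_(x < 2 * K)
    (upper_half (m * x) (+) upper_half (m * f x))).
  apply: eq_bigr => x _; apply: upper_half_mul_abs.
  by rewrite !Gauss_dvdr // orNb.
(* Reindexing the first sum along the permutation [f] makes it equal to the second. *)
rewrite big_split /= [X in X (+) _](reindex_inj f_inj) /=.
exact: addbb.
Qed.

End HalfSystem.

(** The terms at [2 * k] and [2 * k + 1] agree and cancel. *)
Lemma big_addb_half (K : nat) (g : nat -> bool) :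
  \big[addb/false]_(x < 2 * K) g x./2 = false.
Proof.
elim: K => [|K IHK]; first by rewrite big_ord0.
rewrite mulnS add2n !big_ord_recr /= IHK /=.
by rewrite (_ : uphalf (2 * K) = (2 * K)./2) ?addbb; last lia.
Qed.

Lemma big_addb_neq0 (K : nat) : (0 < K)%N ->
  \big[addb/false]_(x < 2 * K) (0 < x)%N = true.
Proof.
case: K => // K _; elim: K => [|K IHK].
  by rewrite !big_ord_recr big_ord0.
by rewrite mulnS add2n 2!big_ord_recr /= IHK.
Qed.

Lemma upper_half_mul_quotient (d u x n : nat) :
  (0 < d)%N -> (0 < u)%N -> (n.+1 = 4 * (d * u))%N -> (x < 2 * (d * u))%N ->
  upper_half (d * u) n (u * x) = odd (x./2 %/ d).
Proof.
move=> d_gt0 u_gt0 nE x_lt.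
rewrite -divn2 -divnMA /upper_half.
have := divn_eq x (2 * d); have : (x %% (2 * d) < 2 * d)%N by rewrite ltn_pmod; lia.
have : (x %/ (2 * d) < u)%N by rewrite ltn_divLR; nia.
move: (x %/ _)%N (x %% _)%N => q r q_lt r_lt xE.
have r_le : (u * r + u <= 2 * (d * u))%N by nia.
(* With [x = 2 * d * q + r], each pair of blocks of length [2 * d] adds [4 * (d * u) = n + 1] to
   [u * x], that is, 1 modulo [n]. The [k] pairs leave the small term [k + u * r < 2 * (d * u)], so
   the parity of [q] alone decides the half. *)
have [k qE] : exists k, q = (odd q + 2 * k)%N by exists q./2; lia.
have -> : (u * x = k * n + (k + u * r + odd q * (2 * (d * u))))%N.
  by move: (odd q : nat) qE => b qE; nia.
rewrite modnMDl modn_small; last by case: (odd q) qE; lia.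
by case: (odd q) qE; lia.
Qed.

Lemma no_square_solution (d u v m : nat) :
  (0 < d)%N -> (0 < u)%N -> (4 * (d * u) * v = m ^ 2 + v + u)%N -> False.
Proof.
move=> d_gt0 u_gt0 E.
have K_gt0 : (0 < d * u)%N by rewrite muln_gt0 d_gt0.
pose n := (4 * (d * u)).-1.
have nE : (n.+1 = 4 * (d * u))%N by rewrite /n; lia.
have mE : (u + m * m = v * n)%N by nia.
have co_nu : coprime n u.
  have : coprime n n.+1 by rewrite coprimenS.
  by rewrite nE mulnA coprimeMr => /andP[].
(* A common divisor of [n] and [m] divides [u = v * n - m * m], and [n] is prime to [u]. *)
have co_nm : coprime n m.
  rewrite /coprime -dvdn1 -(eqP co_nu) dvdn_gcd dvdn_gcdl /=.
  rewrite -(@dvdn_addl (m * m)) ?dvdn_mulr ?dvdn_gcdr //.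
  by rewrite mE dvdn_mull ?dvdn_gcdl.
have := gauss_parity_square _ _ K_gt0 nE _ co_nm.
under eq_bigr => x _.
  have -> : upper_half (d * u) n (m * (m * x))
            = odd (x./2 %/ d) (+) (0 < x)%N.
    rewrite -(upper_half_mul_quotient d u x n) //.
    (* The index 0 is its own opposite and is not flipped; this is the source of the term
       [0 < x]. *)
    have [x_gt0|] := ltnP 0 x; last first.
      by rewrite leqn0 => /eqP ->; rewrite !muln0 addbF.
    rewrite addbT; apply: upper_half_opp => //.
      by rewrite [(m * (m * _))%N]mulnA -mulnDl mE mulnAC dvdn_mull.
    rewrite Gauss_dvdr //; apply/negP => /dvdn_leq.
    by have := ltn_ord x; lia.
  over.
rewrite big_split /= (big_addb_half (d * u) (fun y => odd (y %/ d))).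
by rewrite big_addb_neq0.
Qed.

Lemma type_B_equation_nat (a d u v : nat) :
  (0 < a)%N -> (0 < d)%N -> (0 < u)%N -> (0 < v)%N ->
  type_B_equation a d u v -> (4 * (d * u) * v = a + v + u)%N.
Proof.
move=> a_gt0 d_gt0 u_gt0 v_gt0; rewrite /type_B_equation => E.
have nz (k : nat) : (0 < k)%N -> k%:R != 0 :> rat.
  by rewrite Num.Theory.pnatr_eq0 -lt0n.
have [a0 d0 u0 v0] := And4 (nz _ a_gt0) (nz _ d_gt0) (nz _ u_gt0) (nz _ v_gt0).
apply/eqP; rewrite -(Num.Theory.eqr_nat rat) !natrD !natrM; apply/eqP.
(* The factor [d * u * v * a] is a common multiple of the denominators. *)
transitivity (4 / a%:R * (d%:R * u%:R * v%:R * a%:R) : rat); first by field.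
by rewrite E !natrM; field; rewrite a0 d0 u0 v0.
Qed.

Theorem theorem5 (s m : nat) (s_gt0 : (0 < s)%N) (s_square : s = (m ^ 2)%N) :
  (~ exists d u v : nat,
       [/\ (0 < d)%N, (0 < u)%N, (0 < v)%N &
           4 / s%:R = 1 / (d * u * v)%:R + 1 / (d * u * s)%:R
                      + 1 / (d * v * s)%:R :> rat])
  /\ (~ exists t : nat * nat * nat, type_B_solution s t).
Proof.
have no_sol d u v : (0 < d)%N -> (0 < u)%N -> (0 < v)%N ->
    type_B_equation s d u v -> False.
  move=> d_gt0 u_gt0 v_gt0 /type_B_equation_nat E.
  by apply: (no_square_solution d u v m) => //; rewrite -s_square E.
split; first by case=> d [u [v [d_gt0 u_gt0 v_gt0]]]; apply: no_sol.
by case=> t [d [u [v [d_gt0 u_gt0 v_gt0 _]]]]; apply: no_sol.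
Qed.
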